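(* The set $\sigma_\infty$ is a dense subset of $\pi_\infty$; that is, $\sigma_\infty \subset \pi_\infty$ and every point of $\pi_\infty$ lies in the closure (in $\mathbb{C}$) of $\sigma_\infty$.
   Context: $\mathbb{N}=\{1,2,3,\dots\}$, and $\operatorname{sp}(\cdot)$ denotes the spectrum of a matrix or bounded operator. For $n\in\mathbb{N}$ and $k,l\in\{\pm1\}^n$, let $A^{k,l}_{fin}\in\mathbb{C}^{(n+1)\times(n+1)}$ be the tridiagonal matrix with zero diagonal, subdiagonal $k_1,\dots,k_n$ and superdiagonal $l_1,\dots,l_n$; that is, $(A^{k,l}_{fin})_{j+1,j}=k_j$ and $(A^{k,l}_{fin})_{j,j+1}=l_j$ for $1\le j\le n$, all other entries being $0$. For $m\in\mathbb{N}$ and $k,l\in\{\pm1\}^m$, extend $k$ and $l$ to $m$-periodic sequences indexed by $\mathbb{Z}$ (so $k_{j+m}=k_j$, $l_{j+m}=l_j$ for all $j\in\mathbb{Z}$), and let $A^{k,l}_{per}$ be the bounded linear operator on $\ell^2(\mathbb{Z})$ (complex square-summable bi-infinite sequences) given by the bi-infinite tridiagonal matrix with $(A^{k,l}_{per})_{j+1,j}=k_j$ and $(A^{k,l}_{per})_{j,j+1}=l_j$ for all $j\in\mathbb{Z}$, all other entries being $0$. Define $$\sigma_\infty := \bigcup_{n\in\mathbb{N}}\ \bigcup_{k,l\in\{\pm1\}^n}\operatorname{sp}(A^{k,l}_{fin}),\qquad \pi_\infty := \bigcup_{m\in\mathbb{N}}\ \bigcup_{k,l\in\{\pm1\}^m}\operatorname{sp}(A^{k,l}_{per}).$$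 *)

(* Defs.v *)
From HB Require Import structures.
From mathcomp Require Import all_boot all_order all_algebra.
From mathcomp Require Import all_classical all_reals all_analysis.
From mathcomp Require Import finmap complex ring lra.

Set Implicit Arguments.
Unset Strict Implicit.
Unset Printing Implicit Defensive.

Import Order.TTheory GRing.Theory Num.Theory.
Import numFieldNormedType.Exports.
Import Normc.

Local Open Scope classical_set_scope.
Local Open Scope complex_scope.
Local Open Scope ring_scope.

(* The usual topology is only available on the regular algebra of an abstract
   field; this makes it canonical on the concrete type R[i]. *)
HB.instance Definition _ (R : rcfType) := NormedModule.copy R[i] (R[i]^o).

(* The spectrum of a bounded operator T: the a for which T - a I has no bounded
   two-sided inverse. *)
Definition spectrum (K : numFieldType) (V : normedModType K)
    (T : {linear V -> V}) : set K :=
  [set a | ~ exists S : {linear V -> V},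
     [/\ continuous S,
         forall v, S (T v - a *: v) = v &
         forall v, T (S v) - a *: S v = v]].

Definition mx_spectrum (F : fieldType) (n : nat) (A : 'M[F]_n) : set F :=
  [set a | A - a%:M \notin unitmx].

Definition sq_summable (R : realType) (u : int -> R[i]) : Prop :=
  summable [set: int] (fun j => (normc (u j) ^+ 2)%:E).

Record l2 (R : realType) := L2 {
  l2_fun :> int -> R[i];
  _ : `[< sq_summable l2_fun >] }.

Section l2_theory.
Variable R : realType.
Local Notation C := R[i].
Implicit Types (u v : int -> C) (f : int -> R) (c : R).

HB.instance Definition _ := [isSub for @l2_fun R].
HB.instance Definition _ := [Choice of l2 R by <:].

Lemma esum_leP f c : (\esum_(j in [set: int]) (f j)%:E <= c%:E)%E <->
  forall s, uniq s -> \sum_(j <- s) f j <= c.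
Proof.
split=> [le_c s us|le_c].
  rewrite -lee_fin; apply: le_trans le_c.
  apply: esum_ge; exists [set` s]; first by split; [exact: finite_seq|].
  by rewrite -fsbig_seq// sumEFin.
apply: ge_ereal_sup => _ [X [finX _] <-].
rewrite fsbig_finite//= sumEFin lee_fin.
exact/le_c/fset_uniq.
Qed.

Definition l2_mass u : R :=
  fine (\esum_(j in [set: int]) (normc (u j) ^+ 2)%:E).

Lemma sq_summableE u : sq_summable u =
  (\esum_(j in [set: int]) (normc (u j) ^+ 2)%:E < +oo)%E.
Proof.
rewrite /sq_summable /summable; congr (_ < _)%E.
by apply: eq_esum => j _ /=; rewrite ger0_norm ?sqr_ge0.
Qed.

Lemma l2_massE u : sq_summable u ->
  \esum_(j in [set: int]) (normc (u j) ^+ 2)%:E = (l2_mass u)%:E.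
Proof.
rewrite sq_summableE /l2_mass => ufin; rewrite fineK// ge0_fin_numE//.
by apply: esum_ge0 => j _; rewrite lee_fin sqr_ge0.
Qed.

Lemma l2_mass_ge0 u : 0 <= l2_mass u.
Proof. by apply/fine_ge0/esum_ge0 => j _; rewrite lee_fin sqr_ge0. Qed.

Lemma l2_mass_ub u s : sq_summable u -> uniq s ->
  \sum_(j <- s) normc (u j) ^+ 2 <= l2_mass u.
Proof. by move=> /l2_massE uE; apply: (esum_leP _ _).1; rewrite uE. Qed.

Lemma l2_mass_lub u c :
  (forall s, uniq s -> \sum_(j <- s) normc (u j) ^+ 2 <= c) ->
  sq_summable u /\ l2_mass u <= c.
Proof.
move=> /esum_leP le_c; have su : sq_summable u.
  by rewrite sq_summableE; apply: le_lt_trans le_c _; rewrite ltry.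
by split=> //; rewrite -lee_fin -l2_massE.
Qed.

Lemma normc_ge0 (x : C) : 0 <= normc x.
Proof. by case: x => a b; exact: sqrtr_ge0. Qed.

Lemma sqrD_conv (a b p q : R) : 0 < p -> 0 < q ->
  (a + b) ^+ 2 <= (p + q) * (a ^+ 2 / p + b ^+ 2 / q).
Proof.
move=> p0 q0; rewrite -subr_ge0.
have -> : (p + q) * (a ^+ 2 / p + b ^+ 2 / q) - (a + b) ^+ 2 =
  (a * q - b * p) ^+ 2 / (p * q).
  by have := lt0r_neq0 p0; have := lt0r_neq0 q0 => ? ?; field; apply/andP.
by rewrite divr_ge0 ?sqr_ge0// mulr_ge0// ltW.
Qed.

Lemma sq_sumD (u v : int -> C) (p q : R) s : 0 < p -> 0 < q ->
  sq_summable u -> sq_summable v -> uniq s ->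
  \sum_(j <- s) normc (u j + v j) ^+ 2 <=
    (p + q) * (l2_mass u / p + l2_mass v / q).
Proof.
move=> p0 q0 su sv us.
have step j : normc (u j + v j) ^+ 2 <=
    (p + q) * (normc (u j) ^+ 2 / p + normc (v j) ^+ 2 / q).
  apply: le_trans (sqrD_conv _ _ p0 q0).
  rewrite ler_sqr ?nnegrE ?addr_ge0 ?normc_ge0//; exact: le_normcD.
apply: (le_trans (ler_sum _ (fun j _ => step j))).
rewrite -mulr_sumr big_split/= -!mulr_suml ler_wpM2l ?addr_ge0 ?(ltW p0) ?(ltW q0)//.
by rewrite lerD// ler_wpM2r ?invr_ge0 ?(ltW p0) ?(ltW q0)// l2_mass_ub.
Qed.

Lemma sq_sumZ (a : C) u s : sq_summable u -> uniq s ->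
  \sum_(j <- s) normc (a * u j) ^+ 2 <= normc a ^+ 2 * l2_mass u.
Proof.
move=> su us; under eq_bigr do rewrite normcM exprMn.
by rewrite -mulr_sumr ler_wpM2l ?sqr_ge0// l2_mass_ub.
Qed.

Lemma sq_summable0 : sq_summable (0 : int -> C).
Proof.
by apply: (l2_mass_lub (c := 0) _).1 => s _; rewrite big1// => j _; rewrite normc0 expr0n.
Qed.

Definition l2_pred : {pred int -> C} := fun u => `[< sq_summable u >].

Lemma l2_submod_closed : submod_closed l2_pred.
Proof.
split=> [|a u v]; first exact/asboolP/sq_summable0.
move=> /asboolP su /asboolP sv; apply/asboolP.
have [sau _] := l2_mass_lub (fun s => sq_sumZ a su (s := s)).
exact: (l2_mass_lub (fun s => sq_sumD ltr01 ltr01 sau sv (s := s))).1.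
Qed.

HB.instance Definition _ :=
  GRing.isSubmodClosed.Build C (int -> C) l2_pred l2_submod_closed.
HB.instance Definition _ :=
  GRing.SubChoice_isSubLmodule.Build C (int -> C) l2_pred (l2 R) l2_submod_closed.

Lemma l2_fun_summable (x : l2 R) : sq_summable x.
Proof. by case: x => u /= /asboolP. Qed.

Lemma l2P (x y : l2 R) : (forall j, x j = y j) -> x = y.
Proof. by move=> xy; apply/val_inj/funext => j; exact: xy. Qed.

(* The norm of a normed R[i]-module takes its values in R[i]. *)
Definition l2_norm (x : l2 R) : C := (Num.sqrt (l2_mass x))%:C.

Lemma l2_norm0_eq0 (x : l2 R) : l2_norm x = 0 -> x = 0.
Proof.
move=> [] /eqP; rewrite sqrtr_eq0 => m0; apply: l2P => j.
have := l2_mass_ub (l2_fun_summable x) (s := [:: j]) isT.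
rewrite big_seq1 => /le_trans/(_ m0) n0; apply: eq0_normc.
by apply/eqP; rewrite -sqrf_eq0 eq_le n0 sqr_ge0.
Qed.

Lemma l2_normZ (a : C) (x : l2 R) : l2_norm (a *: x) = `|a| * l2_norm x.
Proof.
have -> : `|a| = (normc a)%:C by [].
rewrite /l2_norm -rmorphM/=; congr (_ %:C).
have le_mass b (y : l2 R) : l2_mass (b *: y) <= normc b ^+ 2 * l2_mass y.
  by apply: (l2_mass_lub _).2 => s; exact/sq_sumZ/l2_fun_summable.
have -> : l2_mass (a *: x) = normc a ^+ 2 * l2_mass x.
  apply: le_anti; rewrite le_mass/=.
  have [->|a0] := eqVneq a 0; first by rewrite normc0 expr0n mul0r l2_mass_ge0.
  have na : 0 < normc a.
    by rewrite lt_def normc_ge0 andbT; apply: contra a0 => /eqP/eq0_normc ->.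
  rewrite -ler_pdivlMl ?exprn_gt0// -exprVn -normcV.
  have aK : a^-1 *: (a *: x) = x by rewrite scalerA mulVf// scale1r.
  by have := le_mass a^-1 (a *: x); rewrite {1}aK.
by rewrite sqrtrM ?sqr_ge0// sqrtr_sqr ger0_norm ?normc_ge0.
Qed.

Lemma l2_normD (x y : l2 R) : l2_norm (x + y) <= l2_norm x + l2_norm y.
Proof.
have [/l2_norm0_eq0 ->|x0] := eqVneq (l2_norm x) 0.
  by rewrite add0r lerDr lecR sqrtr_ge0.
have [/l2_norm0_eq0 ->|y0] := eqVneq (l2_norm y) 0.
  by rewrite addr0 lerDl lecR sqrtr_ge0.
rewrite /l2_norm -rmorphD lecR /=.
have pos (z : l2 R) : l2_norm z != 0 -> 0 < Num.sqrt (l2_mass z).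
  move=> z0; rewrite lt_def sqrtr_ge0 andbT.
  by apply: contra z0 => /eqP z0; rewrite /l2_norm z0.
move: (pos _ x0) (pos _ y0); set p := Num.sqrt _; set q := Num.sqrt _ => p0 q0.
have pE : l2_mass x = p ^+ 2 by rewrite sqr_sqrtr ?l2_mass_ge0.
have qE : l2_mass y = q ^+ 2 by rewrite sqr_sqrtr ?l2_mass_ge0.
rewrite -[leRHS]ger0_norm ?addr_ge0 ?(ltW p0) ?(ltW q0)// -sqrtr_sqr ler_wsqrtr//.
have := (l2_mass_lub (fun s =>
  sq_sumD p0 q0 (l2_fun_summable x) (l2_fun_summable y) (s := s))).2.
by rewrite pE qE !expr2 !mulfK ?lt0r_neq0.
Qed.

HB.instance Definition _ :=
  Lmodule_isNormed.Build C (l2 R) l2_normD l2_normZ l2_norm0_eq0.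

End l2_theory.

(* Sign vectors (k_1, ..., k_n) are tuples indexed from 0, so that k_j is the
   entry of index j - 1. *)
Definition pm1 (R : realType) (n : nat) : set (n.-tuple R[i]) :=
  [set k | forall j : 'I_n, tnth k j = 1 \/ tnth k j = -1].

Definition A_fin (R : realType) (n : nat) (k l : n.-tuple R[i]) :
    'M[R[i]]_n.+1 :=
  \matrix_(i, j) (if i == j.+1 :> nat then k`_j
                  else if j == i.+1 :> nat then l`_i else 0).

Definition per_ext (R : realType) (m : nat) (k : m.-tuple R[i]) (j : int) :
    R[i] :=
  k`_`|((j - 1) %% m)%Z|.

Definition per_mx (R : realType) (m : nat) (k l : m.-tuple R[i])
    (i j : int) : R[i] :=
  if i == j + 1 then per_ext k j
  else if j == i + 1 then per_ext l i else 0.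

(* The sum is finitely supported for band matrices such as per_mx (it would be 0
   by convention on a row with infinitely many nonzero terms). *)
Definition mx_act (R : realType) (a : int -> int -> R[i]) (u : int -> R[i])
    (i : int) : R[i] :=
  \sum_(j \in [set: int]) a i j * u j.

Section A_per_theory.
Variables (R : realType) (m : nat) (k l : m.-tuple R[i]).
Local Notation C := R[i].

Lemma per_mx_actE (u : int -> C) i : mx_act (per_mx k l) u i =
  per_ext k (i - 1) * u (i - 1) + per_ext l i * u (i + 1).
Proof.
rewrite /mx_act -(fsbig_widen [set` [:: i - 1; i + 1]])//; last first.
  move=> j [_ /=]; rewrite !inE => /negP; rewrite negb_or => /andP[j1 j2].
  by rewrite /per_mx (negPf j2) -subr_eq eq_sym (negPf j1) mul0r.
have ii : i - 1 != i + 1 by rewrite -subr_eq0 opprD addrACA subrr.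
rewrite -fsbig_seq ?big_cons ?big_nil ?addr0/=; last by rewrite inE ii.
rewrite addr0 /per_mx subrK eqxx eqxx ifN//.
by rewrite -addrA eq_sym -subr_eq0 addrAC subrr.
Qed.

Definition coef_bound (t : m.-tuple C) : R := \sum_(x <- t) normc x.

Lemma per_ext_bound (t : m.-tuple C) j :
  normc (per_ext t j) ^+ 2 <= coef_bound t ^+ 2.
Proof.
have cb0 : 0 <= coef_bound t by apply: sumr_ge0 => x _; exact: normc_ge0.
rewrite ler_sqr ?nnegrE ?normc_ge0// /per_ext.
have [lt_s|ge_s] := ltnP `|((j - 1) %% m)%Z|%N (size t); last first.
  by rewrite nth_default// normc0.
rewrite /coef_bound (perm_big _ (perm_to_rem (mem_nth 0 lt_s)))/= big_cons.
by rewrite lerDl sumr_ge0// => x _; exact: normc_ge0.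
Qed.

Definition A_per_bound : R :=
  2 * (coef_bound k ^+ 2 + coef_bound l ^+ 2).

Lemma A_per_mass (u : int -> C) : sq_summable u ->
  sq_summable (mx_act (per_mx k l) u) /\
  l2_mass (mx_act (per_mx k l) u) <= A_per_bound * l2_mass u.
Proof.
move=> su; apply: l2_mass_lub => s us.
have shift c : \sum_(j <- s) normc (u (j + c)) ^+ 2 <= l2_mass u.
  rewrite -(big_map (fun j => j + c) xpredT (fun j => normc (u j) ^+ 2)).
  by apply: l2_mass_ub => //; rewrite map_inj_uniq//; exact: addIr.
have step j : normc (mx_act (per_mx k l) u j) ^+ 2 <=
    2 * (coef_bound k ^+ 2 * normc (u (j - 1)) ^+ 2 +
         coef_bound l ^+ 2 * normc (u (j + 1)) ^+ 2).
  rewrite per_mx_actE.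
  apply: (@le_trans _ _ ((normc (per_ext k (j - 1) * u (j - 1)) +
                          normc (per_ext l j * u (j + 1))) ^+ 2)).
    rewrite ler_sqr ?nnegrE ?addr_ge0 ?normc_ge0//; exact: le_normcD.
  apply: le_trans (sqrD_conv _ _ ltr01 ltr01) _.
  rewrite !divr1 ler_wpM2l// !normcM !exprMn.
  by rewrite lerD// ler_wpM2r ?sqr_ge0 ?per_ext_bound.
apply: (le_trans (ler_sum _ (fun j _ => step j))).
rewrite -mulr_sumr big_split/= -!mulr_sumr /A_per_bound -mulrA ler_wpM2l//.
by rewrite mulrDl lerD// ler_wpM2l ?sqr_ge0.
Qed.

Lemma A_per_subproof (x : l2 R) : `[< sq_summable (mx_act (per_mx k l) x) >].
Proof. exact/asboolP/(A_per_mass (l2_fun_summable x)).1. Qed.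

Definition A_per (x : l2 R) : l2 R := L2 (A_per_subproof x).

Lemma A_perE (x : l2 R) i : A_per x i =
  per_ext k (i - 1) * x (i - 1) + per_ext l i * x (i + 1).
Proof. exact: per_mx_actE. Qed.

Lemma A_per_is_linear : linear A_per.
Proof.
move=> a x y; apply: l2P => i.
have lin (z w : l2 R) j : (a *: z + w) j = a * z j + w j by [].
by rewrite lin !A_perE !lin; ring.
Qed.

HB.instance Definition _ :=
  GRing.isLinear.Build C (l2 R) (l2 R) *:%R A_per A_per_is_linear.

Lemma A_per_continuous : continuous A_per.
Proof.
apply: bounded_linear_continuous; apply/linear_boundedP.
have b0 : 0 <= A_per_bound by rewrite mulr_ge0// addr_ge0// sqr_ge0.
exists (Num.sqrt A_per_bound)%:C; split.
  by rewrite realE lecR sqrtr_ge0.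
move=> r /ltW le_r x; apply: le_trans (ler_wpM2r (normr_ge0 x) le_r).
have nE (z : l2 R) : `|z| = l2_norm z by [].
rewrite !nE /l2_norm -rmorphM lecR.
rewrite -sqrtrM// ler_wsqrtr//.
exact: (A_per_mass (l2_fun_summable x)).2.
Qed.

End A_per_theory.

Definition sigma_infty (R : realType) : set R[i] :=
  [set a | exists n : nat, (0 < n)%N /\
     exists k l : n.-tuple R[i],
       [/\ pm1 k, pm1 l & mx_spectrum (A_fin k l) a]].

Definition pi_infty (R : realType) : set R[i] :=
  [set a | exists m : nat, (0 < m)%N /\
     exists k l : m.-tuple R[i],
       [/\ pm1 k, pm1 l & spectrum (A_per k l) a]].

Arguments sigma_infty R : clear implicits.
Arguments pi_infty R : clear implicits.

(* Main.v *)
From HB Require Import structures.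
Require Import Defs.
From mathcomp Require Import all_boot all_order all_algebra.
From mathcomp Require Import all_classical all_reals all_analysis.
From mathcomp Require Import complex ring lra zify.

(* Let T = A_per have period m and put M = 2m. The transfer matrix over M sites
   has determinant 1 and its trace p is a polynomial in the spectral parameter
   that does not depend on the starting site, so Cayley-Hamilton gives
   p(T) = E^M + E^-M, where E is the shift of l2. If a is in the spectrum of T
   then E^M + E^-M - p(a), being a multiple of T - a, is not invertible; writing
   p(a) = z + 1/z it factors as -(1/z) (1 - z E^M) (1 - z E^-M), so |z| = 1 and
   p(a) lies in [-2, 2].

   If p(b) = 2 cos (j pi / N) with 0 < j < N, the solution u of T u = b u with
   u_0 = 0 and u_1 = 1 satisfies the Chebyshev recurrence along multiples of M,
   hence u_(NM) = 0 and b is an eigenvalue of a finite section of size NM - 1.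
   These values are dense in [-2, 2], and roots of p - w near a exist for w
   near p(a): this gives the density.

   Conversely an eigenvector v of A_fin extends to the periodic sequence
   (v, 0, reversed v, 0): the reflected half solves the equation when the two
   off-diagonals are exchanged, and the free signs next to the zeros cancel the
   two neighbours. Truncating this sequence contradicts a bounded inverse. *)

Set Implicit Arguments.
Unset Strict Implicit.
Unset Printing Implicit Defensive.

Import Order.TTheory GRing.Theory Num.Theory.
Import numFieldNormedType.Exports.
Import Normc.

Local Open Scope classical_set_scope.
Local Open Scope complex_scope.
Local Open Scope ring_scope.

(** * Transfer matrices *)

Lemma det_mx22 (R : comPzRingType) (A : 'M[R]_2) :
  \det A = A 0 0 * A 1 1 - A 0 1 * A 1 0.
Proof.
rewrite (expand_det_row _ 0) !big_ord_recl big_ord0 addr0 /cofactor !det_mx11 !mxE.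
rewrite expr0 mul1r expr1 mulN1r mulrN.
have -> : lift (0 : 'I_2) (0 : 'I_1) = 1 by exact: val_inj.
by have -> : lift (1 : 'I_2) (0 : 'I_1) = 0 by exact: val_inj.
Qed.

Section Transfer.
Variables (F : fieldType) (k l : int -> F) (m : nat).
Hypothesis k_sq : forall j, k j ^+ 2 = 1.
Hypothesis l_sq : forall j, l j ^+ 2 = 1.
Hypothesis kP : forall j : int, k (j + m%:Z) = k j.
Hypothesis lP : forall j : int, l (j + m%:Z) = l j.

(* Maps (x_j, x_(j-1)) to (x_(j+1), x_j) when
   k_(j-1) x_(j-1) + l_j x_(j+1) = 'X x_j. *)
Definition step_mx (j : int) : 'M[{poly F}]_2 :=
  \matrix_(a, b) if a == 0 then (if b == 0 then l j *: 'X else (- (k (j - 1) * l j))%:P)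
                 else (b == 0)%:R.

Fixpoint transfer_mx (j : int) (i : nat) : 'M[{poly F}]_2 :=
  if i is i'.+1 then step_mx (j + i'%:Z) *m transfer_mx j i' else 1%:M.

Lemma transfer_mxSl j i :
  transfer_mx j i.+1 = transfer_mx (j + 1) i *m step_mx j.
Proof.
elim: i => [|i IH]; first by rewrite /= addr0 mulmx1 mul1mx.
rewrite -[LHS]/(step_mx (j + i.+1%:Z) *m transfer_mx j i.+1) IH mulmxA /=.
by rewrite -addrA -intS.
Qed.

Lemma transfer_mxD j i i' :
  transfer_mx j (i + i') = transfer_mx (j + i'%:Z) i *m transfer_mx j i'.
Proof.
elim: i => [|i IH] /=; first by rewrite mul1mx.
by rewrite IH mulmxA -addrA -PoszD addnC.
Qed.

Lemma step_mx_per j : step_mx (j + m%:Z) = step_mx j.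
Proof. by apply/matrixP => a b; rewrite !mxE lP -{1}addrAC kP. Qed.

Lemma transfer_mx_per j i : transfer_mx (j + m%:Z) i = transfer_mx j i.
Proof. by elim: i => //= i ->; rewrite addrAC step_mx_per. Qed.

(** One step has determinant [k (j - 1) * l j], a square root of 1, so only the square of the
    determinant is known for a general block. *)
Lemma det_transfer_mx_sq j i : \det (transfer_mx j i) ^+ 2 = 1.
Proof.
elim: i => [|i IH]; first by rewrite /= det1 expr1n.
rewrite /= det_mulmx exprMn IH mulr1 det_mx22 !mxE /= mulr0 sub0r mulr1.
rewrite -rmorphN opprK.
by rewrite -rmorphXn /= exprMn k_sq l_sq mulr1 rmorph1.
Qed.

(** Moving the start by one site takes the first factor off one end and, by periodicity, puts it
    back at the other; the trace is invariant under this cyclic move. *)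
Lemma mxtrace_transfer_mx j i :
  \tr (transfer_mx (j + i%:Z) m) = \tr (transfer_mx j m).
Proof.
elim: i => [|i IH]; first by rewrite addr0.
rewrite -{}IH intS addrA addrAC; move: (j + i%:Z) => {}j.
case: m step_mx_per => [|m'] // per.
by rewrite (transfer_mxSl j) mxtrace_mulC -(per j) intS addrA.
Qed.
End Transfer.

(* The sites are grouped into double periods, over which the transfer matrix
   is a square and hence has determinant 1. *)
Definition discriminant (F : fieldType) (k l : int -> F) (m : nat) : {poly F} :=
  \tr (transfer_mx k l 0 (m + m)).

Section Discriminant.
Variables (F : fieldType) (k l : int -> F) (m : nat).
Hypothesis k_sq : forall j, k j ^+ 2 = 1.
Hypothesis l_sq : forall j, l j ^+ 2 = 1.
(** [h j q] models the value at site j of q(T) x. Leaving it abstract covers both T acting on l2 and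
    a scalar solution, where [h j q] is [q.[b] * u j]. *)
Variable h : int -> {poly F} -> F.
Hypothesis hD : forall j, {morph h j : q r / q + r}.
Hypothesis hZ : forall j a q, h j (a *: q) = a * h j q.
Hypothesis hX : forall j q,
  h j ('X * q) = k (j - 1) * h (j - 1) q + l j * h (j + 1) q.

Lemma transfer_mxE j i q (P := transfer_mx k l j i) :
  h (j + i%:Z) q = h j (P 0 0 * q) + h (j - 1) (P 0 1 * q) /\
  h (j + i%:Z - 1) q = h j (P 1 0 * q) + h (j - 1) (P 1 1 * q).
Proof.
rewrite {}/P; elim: i q => [|i IH] q.
  rewrite addr0 /= !mxE /= !mul1r !mul0r.
  have h0 n : h n 0 = 0 by rewrite -(scale0r 0) hZ mul0r.
  by rewrite !h0 addr0 add0r.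
have -> : j + i.+1%:Z = j + i%:Z + 1 by rewrite intS; ring.
have [e1 e2] := IH q; have [e3 _] := IH ('X * q).
rewrite hX e2 in e3; rewrite addrK e1; split; last first.
  by rewrite /= !mxE !big_ord_recl !big_ord0 !mxE /= !addr0 !mul0r !addr0 !mul1r.
rewrite -[LHS]mul1r -(l_sq (j + i%:Z)) expr2 -mulrA.
rewrite (_ : l (j + i%:Z) * h (j + i%:Z + 1) q = h j (transfer_mx k l j i 0 0 * ('X * q)) +
  h (j - 1) (transfer_mx k l j i 0 1 * ('X * q)) - k (j + i%:Z - 1) *
  (h j (transfer_mx k l j i 1 0 * q) + h (j - 1) (transfer_mx k l j i 1 1 * q))); last first.
  by rewrite -e3; ring.
rewrite /= !mxE !big_ord_recl !big_ord0 !mxE /= !addr0.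
rewrite !mulrDl !hD -!mulrA !mul_polyC -!scalerAl !hZ.
rewrite (_ : lift 0 0 = 1); last exact: val_inj.
rewrite !(mulrCA _ 'X q); ring.
Qed.

Hypothesis kP : forall j : int, k (j + m%:Z) = k j.
Hypothesis lP : forall j : int, l (j + m%:Z) = l j.

(** Trace invariance only moves forward, so a negative j is joined to 0 by starting from j. *)
Lemma discriminantE j : discriminant k l m = \tr (transfer_mx k l j (m + m)).
Proof.
have kPP (i : int) : k (i + (m + m)%:Z) = k i by rewrite PoszD addrA !kP.
have lPP (i : int) : l (i + (m + m)%:Z) = l i by rewrite PoszD addrA !lP.
have inv (i : int) (n : nat) := mxtrace_transfer_mx kPP lPP i n.
case: (lerP 0 j) => [j0|/ltW j0].
  by rewrite /discriminant -(inv 0 `|j|%N) add0r gez0_abs.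
by rewrite /discriminant -(inv j `|j|%N) lez0_abs// subrr.
Qed.

(* Cayley-Hamilton for the transfer matrix over a double period. *)
Lemma discriminant_shift j q :
  h (j + (m + m)%:Z) q + h (j - (m + m)%:Z) q = h j (discriminant k l m * q).
Proof.
set M := (m + m)%N; set P := transfer_mx k l j M.
have detP : P 0 0 * P 1 1 - P 0 1 * P 1 0 = 1.
  rewrite -det_mx22 /P /M transfer_mxD (transfer_mx_per kP lP) det_mulmx -expr2.
  exact: det_transfer_mx_sq.
have PE : transfer_mx k l (j - M%:Z) M = P.
  by rewrite /P -{2}(subrK M%:Z j) {3}/M PoszD addrA !(transfer_mx_per kP lP).
have [up _] := transfer_mxE j M q; rewrite -/P in up.
(* The block from j - M to j has matrix P as well. Subtracting [dn2] from [dn1] cancels the terms at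
   j - M - 1 and leaves det P = 1 times the value at j - M. *)
have [dn1 _] := transfer_mxE (j - M%:Z) M (P 1 1 * q).
have [_ dn2] := transfer_mxE (j - M%:Z) M (P 0 1 * q).
rewrite PE subrK in dn1 dn2.
rewrite (discriminantE j) -/P /mxtrace !big_ord_recl big_ord0 addr0.
rewrite (_ : lift 0 0 = 1); last exact: val_inj.
rewrite mulrDl hD {}up -addrA; congr (_ + _).
rewrite dn1 dn2.
have -> : h (j - M%:Z) q = h (j - M%:Z) ((P 0 0 * P 1 1 - P 0 1 * P 1 0) * q).
  by rewrite detP mul1r.
have hN n r : h n (- r) = - h n r by rewrite -scaleN1r hZ mulN1r.
by rewrite mulrBl hD hN -!mulrA !(mulrCA (P 0 1)); ring.
Qed.
End Discriminant.

(** * Bounded inverses *)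

Lemma spectrum_complement (K : numFieldType) (V : normedModType K)
    (T : {linear V -> V}) (a : K) (f : V -> V) :
  linear f -> continuous f -> (forall v, f (T v - a *: v) = v) ->
  (forall v, T (f v) - a *: f v = v) -> ~ spectrum T a.
Proof.
move=> flin fcont fl fr; apply.
pose fL := GRing.isLinear.Build _ _ _ _ f flin.
pose S : {linear V -> V} := HB.pack f fL.
by exists S.
Qed.

(** The lower bound makes L injective, so a chosen preimage map is linear, and it bounds that map by
    1/c. *)
Lemma bounded_below_inverse (K : numFieldType) (V : normedModType K)
    (L : {linear V -> V}) (c : K) : 0 < c ->
  (forall x, c * `|x| <= `|L x|) -> (forall y, exists x, L x = y) ->
  exists2 S : {linear V -> V}, continuous S & cancel L S /\ cancel S L.
Proof.
move=> c0 below /choice[f fK].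
have injL : injective L.
  move=> x y /eqP; rewrite -subr_eq0 -linearB => /eqP Lxy; apply/eqP.
  rewrite -subr_eq0 -normr_eq0 eq_le normr_ge0 andbT -(pmulr_rle0 _ c0).
  by apply: le_trans (below _) _; rewrite Lxy normr0.
have flin : linear f by move=> a x y; apply: injL; rewrite linearP !fK.
pose fL := GRing.isLinear.Build _ _ _ _ f flin.
pose S : {linear V -> V} := HB.pack f fL.
exists S; last by split=> x; [apply: injL; rewrite fK|rewrite fK].
apply/bounded_linear_continuous/linear_boundedP.
exists c^-1; split; first by rewrite realE invr_ge0 (ltW c0).
move=> r /ltW cr x; apply: le_trans (ler_wpM2r (normr_ge0 _) cr).
by rewrite ler_pdivlMl//; apply: le_trans (below _) _; rewrite fK.
Qed.

(** * Geometrically convergent sequences *)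

Section Limits.
Variable R : realType.
Local Notation C := R[i].

Lemma geometric_small (K c e : R) : 0 <= c < 1 -> 0 < e ->
  exists n, K * c ^+ n <= e.
Proof.
move=> /andP[c0 c1] e0.
have : `|c| < 1 by rewrite ger0_norm.
move=> /(cvg_geometric K)/cvgrPdist_le/(_ _ e0)[n _ /(_ n (leqnn n))] /=.
by rewrite sub0r normrN => /(le_trans (ler_norm _)); exists n.
Qed.

Lemma le0_geometric (t K c : R) : 0 <= c < 1 ->
  (forall n, t <= K * c ^+ n) -> t <= 0.
Proof.
move=> c01 tK; rewrite leNgt; apply/negP => t0.
have [n] := geometric_small K c01 (divr_gt0 t0 (ltr0Sn R 1)); rewrite leNgt => /negP; apply.
by apply: lt_le_trans (tK n); rewrite ltr_pdivrMr ?ltr0Sn// ltr_pMr// ltr1n.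
Qed.

(** With D = M / (1 - c) the intervals of centre s n and radius D c^n are nested, because D - c D =
    M; the supremum of their left ends lies in all of them. *)
Lemma geometric_limit (s : nat -> R) (M c : R) : 0 <= c < 1 -> 0 <= M ->
  (forall n, `|s n.+1 - s n| <= M * c ^+ n) ->
  exists L, forall n, `|s n - L| <= M / (1 - c) * c ^+ n.
Proof.
move=> /andP[c0 c1] M0 sM; set D := M / (1 - c).
have DM : D * (1 - c) = M by rewrite divfK// subr_eq0 gt_eqF.
have D0 n : 0 <= D * c ^+ n by rewrite mulr_ge0 ?exprn_ge0 ?divr_ge0 ?subr_ge0// ltW.
pose lo n := s n - D * c ^+ n; pose up n := s n + D * c ^+ n.
have step n : lo n <= lo n.+1 /\ up n.+1 <= up n.
  have := sM n; rewrite ler_norml -DM /lo /up exprS => /andP[].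
  rewrite !mulrA; set t := c ^+ n; rewrite mulrBr mulr1 mulrBl.
  by move=> *; split; lra.
have lo_le : {homo lo : n p / (n <= p)%N >-> n <= p}.
  by apply: homo_leq le_trans _ => // n; have [] := step n.
have up_le : {homo up : n p / (n <= p)%N >-> p <= n}.
  by apply: (homo_leq (r := fun x y => y <= x)) => //
    [y x z xy yz|n]; [exact: le_trans yz xy|have [] := step n].
have lu n p : lo n <= up p.
  apply: (@le_trans _ _ (lo (maxn n p))); first exact/lo_le/leq_maxl.
  apply: (@le_trans _ _ (up (maxn n p))); last exact/up_le/leq_maxr.
  by have := D0 (maxn n p); rewrite /lo /up => ?; lra.
exists (sup (range lo)) => n.
have hs : has_sup (range lo).
  by split; [exists (lo 0), 0|exists (up 0%N) => _ [p _ <-]; exact: lu].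
rewrite distrC ler_distl; apply/andP; split.
  by apply: (ub_le_sup hs.2); exists n.
by apply: ge_sup; [exact: hs.1|move=> _ [p _ <-]; exact: lu].
Qed.

Lemma normc_le_ReIm (x : C) : normc x <= `|complex.Re x| + `|complex.Im x|.
Proof.
case: x => a b /=; rewrite -[leRHS]ger0_norm ?addr_ge0// -sqrtr_sqr ler_wsqrtr//.
rewrite sqrrD !real_normK ?num_real// -addrA lerD2l lerDr mulrn_wge0// mulr_ge0//.
Qed.

Lemma le_Re_normc (x : C) : `|complex.Re x| <= normc x.
Proof. by case: x => a b /=; rewrite -sqrtr_sqr ler_wsqrtr// lerDl sqr_ge0. Qed.

Lemma le_Im_normc (x : C) : `|complex.Im x| <= normc x.
Proof. by case: x => a b /=; rewrite -sqrtr_sqr ler_wsqrtr// lerDr sqr_ge0. Qed.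

Lemma geometric_limitC (s : nat -> C) (M c : R) : 0 <= c < 1 -> 0 <= M ->
  (forall n, normc (s n.+1 - s n) <= M * c ^+ n) ->
  exists L, forall n, normc (s n - L) <= M / (1 - c) * 2 * c ^+ n.
Proof.
move=> c01 M0 sM.
have [n|x xL] := @geometric_limit (fun n => complex.Re (s n)) M c c01 M0.
  by rewrite /= -raddfB; apply: le_trans (le_Re_normc _) (sM n).
have [n|y yL] := @geometric_limit (fun n => complex.Im (s n)) M c c01 M0.
  by rewrite /= -raddfB; apply: le_trans (le_Im_normc _) (sM n).
exists (x +i* y) => n; apply: le_trans (normc_le_ReIm _) _.
rewrite mulrAC [_ * 2]mulr_natr mulr2n !raddfB /=; exact: lerD.
Qed.
End Limits.

(** * Shifts of l2 *)

Section L2.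
Variable R : realType.
Local Notation C := R[i].
Implicit Types x y : l2 R.

Lemma l2_normE x : `|x| = (Num.sqrt (l2_mass x))%:C. Proof. by []. Qed.

Lemma normC_normc (a : C) : `|a| = (normc a)%:C. Proof. by []. Qed.

Lemma l2D x y j : (x + y) j = x j + y j. Proof. by []. Qed.
Lemma l2N x j : (- x) j = - x j. Proof. by []. Qed.
Lemma l2Z a x j : (a *: x) j = a * x j. Proof. by []. Qed.

Lemma normc_l2_le x j : normc (x j) <= Num.sqrt (l2_mass x).
Proof.
have := l2_mass_ub (l2_fun_summable x) (s := [:: j]) isT.
by rewrite big_seq1 => /ler_wsqrtr; rewrite sqrtr_sqr ger0_norm ?normc_ge0.
Qed.

Lemma l2_shift_mass (s : int) (u : int -> C) : sq_summable u ->
  sq_summable (fun j => u (j + s)) /\ l2_mass (fun j => u (j + s)) <= l2_mass u.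
Proof.
move=> su; apply: l2_mass_lub => t ut.
rewrite -(big_map (fun j => j + s) xpredT (fun j => normc (u j) ^+ 2)).
by apply: l2_mass_ub => //; rewrite map_inj_uniq//; exact: addIr.
Qed.

Lemma l2_shift_subproof (s : int) x : `[< sq_summable (fun j => x (j + s)) >].
Proof. exact/asboolP/(l2_shift_mass s (l2_fun_summable x)).1. Qed.

Definition l2_shift (s : int) x : l2 R := L2 (l2_shift_subproof s x).

Lemma l2_shiftE s x j : l2_shift s x j = x (j + s). Proof. by []. Qed.

Lemma l2_shift_linear s : linear (l2_shift s).
Proof. by move=> a x y; apply: l2P => j. Qed.
HB.instance Definition _ s :=
  GRing.isLinear.Build C (l2 R) (l2 R) *:%R (l2_shift s) (l2_shift_linear s).

Lemma l2_shift_norm s x : `|l2_shift s x| = `|x|.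
Proof.
have le t y : `|l2_shift t y| <= `|y|.
  by rewrite !l2_normE lecR ler_wsqrtr// (l2_shift_mass t (l2_fun_summable y)).2.
apply: le_anti; rewrite le/= -{1}(_ : l2_shift (- s) (l2_shift s x) = x)//.
by apply: l2P => j; rewrite !l2_shiftE addrNK.
Qed.

Definition one_sub_shift (z : C) (s : int) x := x - z *: l2_shift s x.

Lemma one_sub_shift_linear z s : linear (one_sub_shift z s).
Proof.
move=> a x y; rewrite /one_sub_shift linearP scalerDr scalerBr !scalerA mulrC.
by rewrite opprD addrACA.
Qed.
HB.instance Definition _ z s := GRing.isLinear.Build C (l2 R) (l2 R) *:%R
  (one_sub_shift z s) (one_sub_shift_linear z s).

Lemma one_sub_shift_below z s x : (1 - `|z|) * `|x| <= `|one_sub_shift z s x|.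
Proof.
rewrite mulrBl mul1r -{2}(l2_shift_norm s x) -normrZ; exact: lerB_dist.
Qed.

(** The limit is taken site by site, with an error uniform in the site. It lies in l2 because the
    norms of the f n are bounded by a geometric sum. Convergence at each site is enough to verify an
    operator equation. *)
Lemma l2_geometric_limit (f : nat -> l2 R) (M c : R) : 0 <= c < 1 -> 0 <= M ->
  (forall n, `|f n.+1 - f n| <= (M * c ^+ n)%:C) ->
  exists (g : l2 R) (D : R), forall n j, normc (f n j - g j) <= D * c ^+ n.
Proof.
move=> c01 M0 fM; have /andP[c0 c1] := c01.
pose D := M / (1 - c) * 2.
have D0 : 0 <= D by rewrite mulr_ge0// divr_ge0// subr_ge0 ltW.
have [j|g gf] := choice (_ : forall j, exists L, forall n, normc (f n j - L) <= D * c ^+ n).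
  apply: (geometric_limitC c01 M0) => n; rewrite -lecR; apply: le_trans (fM n).
  by rewrite l2_normE lecR -l2N -l2D; exact: normc_l2_le.
have fB n : `|f n| <= `|f 0| + (M / (1 - c))%:C.
  (* The factor 1 - c^n, the exact partial geometric sum, makes the induction close. *)
  have : `|f n| <= `|f 0| + (M / (1 - c) * (1 - c ^+ n))%:C.
    elim: n => [|n IH]; first by rewrite expr0 subrr mulr0 addr0.
    have -> : f n.+1 = f n + (f n.+1 - f n) by rewrite addrC subrK.
    apply: le_trans (ler_normD _ _) _; apply: le_trans (lerD IH (fM n)) _.
    rewrite -addrA lerD2l -rmorphD lecR exprS.
    have cn : 1 - c != 0 by rewrite subr_eq0 gt_eqF.
    rewrite le_eqVlt; apply/orP; left; apply/eqP; field => //.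
  move=> h; apply: le_trans h _; rewrite lerD2l lecR ler_piMr ?divr_ge0 ?subr_ge0 ?(ltW c1)//.
  by rewrite gerBl exprn_ge0.
pose B := Num.sqrt (l2_mass (f 0)) + M / (1 - c).
have fmass n : l2_mass (f n) <= B ^+ 2.
  have := fB n; rewrite !l2_normE -rmorphD lecR -/B => fnB.
  rewrite -[leLHS]sqr_sqrtr ?l2_mass_ge0// ler_sqr ?nnegrE ?sqrtr_ge0//.
  exact: le_trans (sqrtr_ge0 _) fnB.
have [sg _] : sq_summable g /\ l2_mass g <= 2 * B ^+ 2 + 1.
  apply: l2_mass_lub => t ut.
  have c201 : 0 <= c ^+ 2 < 1 by rewrite sqr_ge0 expr_lt1.
  (* The index n depends on the finite family t: the accumulated errors over its sites must total at
     most 1. *)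
  have [n nP] := geometric_small (2 * (size t)%:R * D ^+ 2) c201 (ltr01 (R := R)).
  have step j : normc (g j) ^+ 2 <= 2 * normc (f n j) ^+ 2 + 2 * D ^+ 2 * (c ^+ 2) ^+ n.
    have -> : g j = f n j - (f n j - g j) by rewrite subKr.
    apply: (@le_trans _ _ ((normc (f n j) + normc (f n j - g j)) ^+ 2)).
      rewrite ler_sqr ?nnegrE ?addr_ge0 ?normc_ge0//.
      by rewrite -[normc (f n j - g j)]normcN; exact: le_normcD.
    apply: le_trans (sqrD_conv _ _ ltr01 ltr01) _; rewrite !divr1 mulrDr lerD2l.
    rewrite -mulrA ler_wpM2l// exprAC -exprMn ler_sqr ?nnegrE ?normc_ge0//.
    by rewrite mulr_ge0// exprn_ge0.
  apply: le_trans (ler_sum _ (fun j _ => step j)) _.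
  rewrite big_split/= -mulr_sumr big_const_seq count_predT iter_addr_0; apply: lerD.
    rewrite ler_wpM2l//; apply: le_trans (fmass n).
    by apply: l2_mass_ub => //; exact: l2_fun_summable.
  by rewrite -mulr_natr; apply: le_trans nP; rewrite le_eqVlt; apply/orP; left; apply/eqP; ring.
by exists (L2 (asboolT sg)), D => n j; exact: gf.
Qed.

(** Neumann series: [f n] is the n-th partial sum of the powers of K = z E^s applied to y. *)
Lemma one_sub_shift_surj z s y : `|z| < 1 -> exists x, one_sub_shift z s x = y.
Proof.
rewrite normC_normc -[1]/(1%:C) ltcR => z1; set c := normc z in z1.
have c01 : 0 <= c < 1 by rewrite normc_ge0.
pose K x := z *: l2_shift s x.
pose f n := iter n (fun x => y + K x) 0.
have [|n|x [D xf]] := @l2_geometric_limit f (Num.sqrt (l2_mass y)) c c01.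
- exact: sqrtr_ge0.
- have -> : f n.+1 - f n = iter n K y.
    elim: n => [|n IH]; first by rewrite /= /K linear0 scaler0 addr0 subr0.
    have -> : f n.+2 - f n.+1 = K (f n.+1) - K (f n) by rewrite /f/= opprD addrACA subrr add0r.
    by rewrite /= -IH /K linearB scalerBr.
  elim: n => [|n IH] /=; first by rewrite mulr1.
  rewrite normrZ l2_shift_norm exprS mulrCA rmorphM /=.
  by rewrite ler_wpM2l// lecR normc_ge0.
exists x; apply: l2P => j; apply/eqP; rewrite -subr_eq0; apply/eqP/eq0_normc/eqP.
rewrite eq_le normc_ge0 andbT; apply: (le0_geometric c01 (K := D * 2)) => n.
(* The defect of x is expressed by the errors of two successive partial sums, so it is at most 2 D
   c^n for every n. *)
have -> : one_sub_shift z s x j - y j =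
   - (f n.+1 j - x j) + z * (f n (j + s) - x (j + s)).
  rewrite [f n.+1]iterS -/(f n) /K /one_sub_shift !l2D l2N !l2Z !l2_shiftE; ring.
apply: le_trans (le_normcD _ _) _; rewrite normcN normcM mulrAC mulr_natr mulr2n.
have t0 : 0 <= D * c ^+ n by apply: le_trans (normc_ge0 _) (xf n j).
apply: lerD; last first.
  by apply: le_trans (xf n (j + s)); rewrite ler_piMl ?normc_ge0// ltW.
apply: le_trans (xf n.+1 j) _; rewrite exprS mulrCA ler_piMl// ltW//.
Qed.
End L2.

(** * Polynomials in an operator and the spectrum of A_per *)

Section PolyAction.
Variables (K : fieldType) (V : lmodType K) (T : {linear V -> V}).
Implicit Types (p q : {poly K}) (x y : V).

Definition poly_act q x : V := \sum_(i < size q) q`_i *: iter i T x.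

Lemma poly_act_wide n q x : (size q <= n)%N ->
  poly_act q x = \sum_(i < n) q`_i *: iter i T x.
Proof.
move=> qn; rewrite /poly_act (big_ord_widen n (fun i => q`_i *: iter i T x) qn).
rewrite big_mkcond; apply: eq_bigr => i _; case: ltnP => // ni.
by rewrite nth_default// scale0r.
Qed.

Lemma poly_actD p q x : poly_act (p + q) x = poly_act p x + poly_act q x.
Proof.
set n := maxn (size p) (size q).
rewrite !(@poly_act_wide n) ?leq_maxl ?leq_maxr ?size_polyD//.
by rewrite -big_split; apply: eq_bigr => i _; rewrite coefD scalerDl.
Qed.

Lemma poly_actZ a q x : poly_act (a *: q) x = a *: poly_act q x.
Proof.
rewrite !(@poly_act_wide (size q)) ?size_scale_leq// scaler_sumr.
by apply: eq_bigr => i _; rewrite coefZ scalerA.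
Qed.

Lemma poly_actC a x : poly_act a%:P x = a *: x.
Proof. by rewrite (@poly_act_wide 1) ?size_polyC ?leq_b1// big_ord1 coefC. Qed.

Lemma iter_linear n : linear (fun x => iter n T x).
Proof. by move=> a x y; elim: n => //= n ->; rewrite linearP. Qed.

Lemma poly_act_linear q : linear (poly_act q).
Proof.
move=> a x y; rewrite /poly_act scaler_sumr -big_split; apply: eq_bigr => i _.
by rewrite (iter_linear i) /= scalerDr !scalerA mulrC.
Qed.

Lemma poly_actXr q x : poly_act ('X * q) x = poly_act q (T x).
Proof.
have sq : (size ('X * q)%R <= (size q).+1)%N.
  by rewrite (leq_trans (size_polyMleq _ _))// size_polyX addSn.
rewrite (poly_act_wide _ sq) big_ord_recl coefXM scale0r add0r.
by apply: eq_bigr => i _; rewrite coefXM lift0 iterSr.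
Qed.

Lemma poly_actXl q x : poly_act ('X * q) x = T (poly_act q x).
Proof.
rewrite poly_actXr /poly_act linear_sum; apply: eq_bigr => i _.
by rewrite linearZ -[in RHS]iterS iterSr.
Qed.
End PolyAction.

Lemma poly_act_continuous (K : numFieldType) (V : normedModType K)
  (T : {linear V -> V}) (q : {poly K}) : continuous T -> continuous (poly_act T q).
Proof.
move=> Tc; have itc i : continuous (fun x => iter i T x).
  by elim: i => [|i IH] x; [exact: cvg_id|exact: (continuous_comp (IH x) (Tc _))].
suff sc n : continuous (fun x : V => \sum_(i < n) q`_i *: iter i T x) by exact: sc.
elim: n => [|n IH].
  rewrite (_ : (fun _ => _) = fun=> 0); first exact: cst_continuous.
  by apply/funext => x; rewrite big_ord0.
rewrite (_ : (fun _ => _) =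
    (fun x => \sum_(i < n) q`_i *: iter i T x + q`_n *: iter n T x)).
  by move=> x; apply: cvgD; [exact: IH|apply: cvgZl_tmp; exact: itc].
by apply/funext => x; rewrite big_ord_recr.
Qed.

(** * The discriminant on the spectrum of a periodic operator *)

Section PeriodicSpectrum.
Variable R : realType.
Local Notation C := R[i].

Section Extension.
Variables (m : nat) (t : m.-tuple C).
Hypotheses (m0 : (0 < m)%N) (tpm : pm1 t).

Lemma per_ext_idx_lt (j : int) : (`|((j - 1) %% m)%Z| < m)%N.
Proof.
have mz : m%:Z != 0 by rewrite eqz_nat -lt0n.
by rewrite -ltz_nat gez0_abs ?modz_ge0// ltz_pmod.
Qed.

Lemma per_ext_sqr j : per_ext t j ^+ 2 = 1.
Proof.
rewrite /per_ext -(tnth_nth 0 t (Ordinal (per_ext_idx_lt j))).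
by have [->|->] := tpm (Ordinal (per_ext_idx_lt j)); rewrite ?sqrrN expr1n.
Qed.

Lemma per_ext_per (j : int) : per_ext t (j + m%:Z) = per_ext t j.
Proof. by rewrite /per_ext addrAC modzDr. Qed.
End Extension.

Variables (m : nat) (k l : m.-tuple C).
Hypotheses (m0 : (0 < m)%N) (kpm : pm1 k) (lpm : pm1 l).
Local Notation p := (discriminant (per_ext k) (per_ext l) m).

Lemma discriminant_A_per (x : l2 R) : poly_act (A_per k l) p x =
  l2_shift (m + m)%:Z x + l2_shift (- (m + m)%:Z) x.
Proof.
apply: l2P => j; rewrite l2D !l2_shiftE.
pose h j (q : {poly C}) := poly_act (A_per k l) q x j.
have := @discriminant_shift _ _ _ m (per_ext_sqr m0 kpm) (per_ext_sqr m0 lpm) h _ _ _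
  (per_ext_per k) (per_ext_per l) j 1.
rewrite mulr1 /h -!polyC1 !poly_actC !scale1r => <- //.
- by move=> i q r; rewrite poly_actD.
- by move=> i a q; rewrite poly_actZ.
- by move=> i q; rewrite poly_actXl A_perE.
Qed.

(** The roots of z^2 - w z + 1 are inverse to each other: either one lies inside the unit disc, or
    both are on the circle and w = 2 Re z. *)
Lemma joukowski (w : C) :
  (exists2 t : R, -1 <= t <= 1 & w = (2 * t)%:C) \/
  (exists z : C, [/\ z != 0, `|z| < 1 & w = z + z^-1]).
Proof.
have [z z0 wz] : exists2 z : C, z != 0 & w = z + z^-1.
  pose s := sqrtC (w ^+ 2 - 4).
  have s2 : s ^+ 2 = w ^+ 2 - 4 by rewrite sqrtCK.
  have zz : (w + s) * (w - s) = 4 by rewrite mulrC -subr_sqr s2 opprB addrC subrK.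
  have n0 : w + s != 0.
    by apply/eqP => e; move: zz; rewrite e mul0r => /esym/eqP; rewrite pnatr_eq0.
  exists ((w + s) / 2); first by rewrite mulf_neq0// invr_eq0 pnatr_eq0.
  have n2 : (2 : C) != 0 by rewrite pnatr_eq0.
  have -> : ((w + s) / 2)^-1 = (w - s) / 2.
    apply: (mulIf n0); apply: (mulIf n2); rewrite invf_div divfK// -mulrA -mulrA.
    by rewrite (mulrCA (2^-1)) mulVf// mulr1 [_ * (w + s)]mulrC zz; ring.
  by field.
have [z1|z1|z1] := real_ltgtP (normr_real z) (real1 C).
- by right; exists z.
- by right; exists z^-1; rewrite invr_eq0 invrK addrC normfV invf_lt1 ?normr_gt0.
left; exists (complex.Re z).
  by rewrite -ler_norml -lecR; apply: le_trans (normc_ge_Re z) _; rewrite z1.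
have zV : z^-1 = z^*%C by rewrite invC_norm z1 expr1n invr1 mul1r.
by rewrite wz zV; case: (z) => a b; simpc; rewrite mulr_natl.
Qed.

(** Otherwise p(T) - p(a) has a bounded inverse G, composed of the inverses of its two shift
    factors. Writing p - p(a) = q ('X - a), the map q(T) G then inverts T - a. *)
Lemma spectrum_A_per (a : C) : spectrum (A_per k l) a ->
  exists2 t : R, -1 <= t <= 1 & p.[a] = (2 * t)%:C.
Proof.
move=> aT; have [//|[z [z0 z1 wz]]] := joukowski p.[a]; exfalso; move: aT.
set w := p.[a] in wz; set T : {linear l2 R -> l2 R} := A_per k l.
pose M := (m + m)%:Z.
have inv s := bounded_below_inverse (L := one_sub_shift z s) (c := 1 - `|z|) _
  (one_sub_shift_below z s) (fun y => one_sub_shift_surj s y z1).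
have c0 : 0 < 1 - `|z| by rewrite subr_gt0.
have [U Uc [UK KU]] := inv c0 M; have [V Vc [VK KV]] := inv c0 (- M).
pose Q (x : l2 R) := l2_shift M x + l2_shift (- M) x - w *: x.
have QE x : Q x = - z^-1 *: one_sub_shift z M (one_sub_shift z (- M) x).
  apply: l2P => j; rewrite /Q /one_sub_shift !(l2D, l2N, l2Z, l2_shiftE).
  rewrite addrK wz; field.
  by [].
pose G (x : l2 R) := - z *: V (U x).
have QG x : Q (G x) = x.
  by rewrite QE /G !linearZ /= KV KU scalerA mulrNN mulfV// scale1r.
have GQ x : G (Q x) = x.
  by rewrite QE /G !linearZ /= UK VK scalerA mulrNN mulVf// scale1r.
have [q qE] : exists q, p - w%:P = q * ('X - a%:P).
  by apply/factor_theorem; rewrite rootE !hornerE subrr.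
have pact x : poly_act T ('X * q - a *: q) x = Q x.
  have -> : 'X * q - a *: q = p + (- w)%:P.
    by rewrite rmorphN qE mulrBr mulrC -mul_polyC [a%:P * q]mulrC.
  by rewrite poly_actD discriminant_A_per poly_actC scaleNr.
have qTl x : poly_act T q (T x - a *: x) = Q x.
  rewrite -pact addrC -scaleNr poly_act_linear -poly_actXr -poly_actZ -poly_actD.
  by rewrite scaleNr addrC.
have qTr x : T (poly_act T q x) - a *: poly_act T q x = Q x.
  by rewrite -pact -scaleNr poly_actD poly_actXl -poly_actZ scaleNr.
(* Injectivity of T - a turns the right inverse q(T) G into a left inverse, in place of an argument
   that G commutes with T. *)
have inj x y : T x - a *: x = T y - a *: y -> x = y.
  by move=> e; rewrite -(GQ x) -(GQ y) -!qTl e.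
apply: (@spectrum_complement _ _ T a (fun x => poly_act T q (G x))).
- by move=> b x y; rewrite /G !linearP poly_act_linear.
- move=> v; apply: (@continuous_comp _ _ _ G (poly_act T q));
    last exact/poly_act_continuous/A_per_continuous.
  exact: cvgZl_tmp (continuous_comp (Uc v) (Vc (U v))).
- by move=> v; apply: inj; rewrite qTr QG.
- by move=> v; rewrite qTr QG.
Qed.
End PeriodicSpectrum.

(** * Density *)

Lemma cos_rational_dense (R : realType) (t e : R) : -1 <= t <= 1 -> 0 < e ->
  exists N j : nat, (0 < j < N)%N /\ `|cos (j%:R * pi / N%:R) - t| < e.
Proof.
move=> t1 e0; set phi := acos t.
have tE : cos phi = t by rewrite acosK.
have phi0 : 0 <= phi by exact: acos_ge0.
have phipi : phi <= pi by exact: acos_lepi.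
have p0 := pi_gt0 R.
have /cvgrPdist_lt/(_ e e0)/nbhs_ballP[d /= d0 dP] := @continuous_cos R phi.
(* The grid of step pi / N is finer than the continuity radius d, and N >= 2 leaves an interior grid
   point. *)
pose N := (Num.trunc (pi / d)).+2.
have N0 : 0 < N%:R :> R by rewrite ltr0n.
have Nd : pi / N%:R < d.
  rewrite ltr_pdivrMr// mulrC -ltr_pdivrMr//.
  have /truncn_itv/andP[_ h] : 0 <= pi / d by rewrite divr_ge0// ltW.
  by apply: lt_trans h _; rewrite ltr_nat.
pose y := N%:R * phi / pi.
have y0 : 0 <= y by rewrite divr_ge0// ?mulr_ge0// ltW.
have yN : y <= N%:R by rewrite ler_pdivrMr// ler_wpM2l// ltW.
have /andP[jy yj] := truncn_itv y0; set j0 := Num.trunc y in jy yj.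
have j0N : (j0 <= N)%N by rewrite -(ler_nat R); exact: le_trans jy yN.
(* j is the integer part of y, moved off the excluded ends 0 and N; this stays within one grid
   step. *)
have [j jN yj1] : exists2 j : nat, (0 < j < N)%N & `|y - j%:R| <= 1.
  have [j00|j0pos] := posnP j0.
    exists 1%N => //; move: yj; rewrite j00 => yj.
    by rewrite ler_norml; apply/andP; split; lra.
  have [j0N'|Nj0] := ltnP j0 N.
    exists j0; first by rewrite j0pos j0N'.
    by rewrite -natr1 in yj; rewrite ler_norml; apply/andP; split; lra.
  have e1 : j0 = N by apply/eqP; rewrite eqn_leq j0N.
  exists N.-1; first by rewrite /N /= ltnSn.
  have : N%:R = N.-1%:R + 1 :> R by rewrite natr1.
  by rewrite e1 in jy; rewrite ler_norml => ?; apply/andP; split; lra.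
exists N, j; split=> //.
rewrite distrC -tE; apply: dP; rewrite /ball /=.
have frac (P n f i : R) : P != 0 -> n != 0 ->
    f - i * P / n = (n * f / P - i) * (P / n) by move=> *; field; apply/andP.
apply: le_lt_trans Nd; rewrite frac ?gt_eqF// -/y.
by rewrite normrM (ger0_norm (ltW (divr_gt0 p0 N0))) ler_piMl// ltW// divr_gt0.
Qed.

(** If all roots of p - w were at distance at least d from a, the factorisation would give |p(a) -
    w| >= |lead_coef p| d^deg p, which is the chosen e. *)
Lemma poly_root_near (C : numClosedFieldType) (p : {poly C}) (a d : C) :
  (1 < size p)%N -> 0 < d -> exists2 e : C, 0 < e &
    forall w, `|w - p.[a]| < e -> exists2 b, p.[b] = w & `|b - a| < d.
Proof.
move=> sp d0; have p0 : p != 0 by rewrite -size_poly_gt0 ltnW.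
exists (`|lead_coef p| * d ^+ (size p).-1) => [|w wp].
  by rewrite mulr_gt0 ?exprn_gt0// normr_gt0 lead_coef_eq0.
have sw : (size (- w%:P)%R < size p)%N.
  by rewrite size_polyN (leq_ltn_trans (size_polyC_leq1 w)).
have [r rE] := closed_field_poly_normal (p - w%:P).
rewrite lead_coefDl// in rE.
have sr : size r = (size p).-1.
  have := congr1 (size \o polyseq) rE.
  by rewrite /= size_polyDl// size_scale ?lead_coef_eq0// size_prod_XsubC => ->.
have [/hasP[b br bd]|/hasPn far] := boolP (has (fun b => `|b - a| < d) r).
  exists b => //; apply/eqP; rewrite -subr_eq0.
  have -> : p.[b] - w = (p - w%:P).[b] by rewrite !hornerE.
  by rewrite rE hornerZ mulf_eq0 -rootE root_prod_XsubC br orbT.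
exfalso; move: wp; suff : `|lead_coef p| * d ^+ (size p).-1 <= `|w - p.[a]|.
  by move=> /le_lt_trans h /h; rewrite ltxx.
have -> : `|w - p.[a]| = `|(p - w%:P).[a]| by rewrite distrC !hornerE.
rewrite rE hornerZ normrM ler_wpM2l// horner_prod normr_prod -sr.
elim: r far {rE sr} => [|c r IH] far; first by rewrite big_nil.
rewrite big_cons /= exprS ler_pM ?exprn_ge0// ?(ltW d0)//; last first.
  by apply: IH => x xr; apply: far; rewrite inE xr orbT.
have := far c (mem_head _ _); rewrite !hornerE distrC -real_leNgt//.
by rewrite gtr0_real.
Qed.

(** * Solutions of the three-term recurrence on the integers *)

Section SignRecurrence.
Variables (F : fieldType) (k l : int -> F) (b : F).
Hypothesis k_sq : forall j, k j ^+ 2 = 1.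
Hypothesis l_sq : forall j, l j ^+ 2 = 1.

(** The pair is (u_n, u_(n+1)); multiplying by a sign replaces dividing by it. *)
Fixpoint forward_solution (n : nat) : F * F :=
  if n is n'.+1 then
    let u := forward_solution n' in (u.2, l n'.+1 * (b * u.2 - k n' * u.1))
  else (0, 1).

(** The pair is (u_(-n), u_(1-n)). *)
Fixpoint backward_solution (n : nat) : F * F :=
  if n is n'.+1 then
    let u := backward_solution n' in
    (k (- n'%:Z - 1) * (b * u.1 - l (- n'%:Z) * u.2), u.1)
  else (0, 1).

Lemma sign_recurrence_solution : exists u : int -> F, [/\ u 0 = 0, u 1 = 1 &
  forall j, k (j - 1) * u (j - 1) + l j * u (j + 1) = b * u j].
Proof.
pose u (j : int) := match j with
  | Posz n => (forward_solution n).1 | Negz n => (backward_solution n.+1).1 end.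
exists u; split=> //.
have uN n : u (- n%:Z) = (backward_solution n).1 by case: n.
have uN1 n : u (1 - n%:Z) = (backward_solution n).2.
  by case: n => // n; rewrite intS opprD addNKr uN.
have neg n : k (- n%:Z - 1) * u (- n%:Z - 1) + l (- n%:Z) * u (- n%:Z + 1) =
    b * u (- n%:Z).
  rewrite {2}(_ : - n%:Z - 1 = - n.+1%:Z); last by rewrite intS opprD addrC.
  by rewrite (addrC _ 1) uN1 !uN /= mulrA -expr2 k_sq mul1r subrK.
case=> [[|n]|n]; [exact: (neg 0%N)| |by rewrite NegzE; exact: neg].
rewrite (_ : n.+1%:Z - 1 = n); last by rewrite intS addrAC subrr add0r.
by rewrite -PoszD addn1 /u /= mulrA -expr2 l_sq mul1r addrC subrK.
Qed.
End SignRecurrence.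

Lemma l2_finite_support (R : realType) (u : int -> R[i]) (t : seq int) : uniq t ->
  (forall j, j \notin t -> u j = 0) ->
  sq_summable u /\ l2_mass u <= \sum_(j <- t) normc (u j) ^+ 2.
Proof.
move=> ut u0; apply: l2_mass_lub => s us.
rewrite (bigID (mem t)) /= [X in _ + X]big1 ?addr0; last first.
  by move=> j /u0 ->; rewrite normc0 expr0n.
rewrite [leRHS](bigID (mem s)) /= -[leLHS]addr0 lerD ?sumr_ge0//; last first.
  by move=> j _; rewrite sqr_ge0.
rewrite -[leLHS]big_filter -[leRHS]big_filter (perm_big [seq j <- t | j \in s])//=.
apply: uniq_perm; rewrite ?filter_uniq// => j.
by rewrite !mem_filter andbC.
Qed.

(** The vector is indexed from 1 and padded by zeros at 0 and n + 2, so the end rows look like the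
    others: the stray [k]_0[in row 0 and the default]l[_n] in row n multiply these zeros. *)
Lemma A_fin_mulE (R : realType) (n : nat) (k l : n.-tuple R[i]) (f : nat -> R[i])
    (i : 'I_n.+1) : f 0%N = 0 -> f n.+2 = 0 ->
  \sum_j A_fin k l i j * f j.+1 = k`_i.-1 * f i + l`_i * f i.+2.
Proof.
move=> f0 fn.
have -> : \sum_j A_fin k l i j * f j.+1 =
    (\sum_(j < n.+1) (if i == j.+1 :> nat then k`_j * f j.+1 else 0)) +
    \sum_(j < n.+1) (if j == i.+1 :> nat then l`_i * f j.+1 else 0).
  rewrite -big_split; apply: eq_bigr => j _; rewrite mxE.
  case: (eqVneq (i : nat) j.+1) => [->|_]; last by case: ifP; rewrite /= ?mul0r add0r.
  by rewrite ltn_eqF //= addr0.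
congr (_ + _).
  case: i => [[|i] /= ilt]; first by rewrite f0 mulr0 big1.
  rewrite (bigD1 (Ordinal (ltnW ilt)))//= eqxx big1 ?addr0// => j.
  by rewrite -val_eqE /= eqSS => /negPf ji; rewrite eq_sym ji.
have [iltn|nlei] := ltnP i n.
  rewrite (bigD1 (Ordinal (iltn : (i.+1 < n.+1)%N)))//= eqxx big1 ?addr0// => j.
  by rewrite -val_eqE /= => /negPf ->.
have -> : i = n :> nat by apply/eqP; rewrite eqn_leq nlei andbT -ltnS.
rewrite fn mulr0 big1// => j _; case: ifP => // /eqP jn.
by have := ltn_ord j; rewrite jn ltnn.
Qed.

Lemma mx_spectrum_eigenvector (F : fieldType) (n : nat) (A : 'M[F]_n) (a : F)
    (v : 'cV_n) : v != 0 -> A *m v = a *: v -> mx_spectrum A a.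
Proof.
move=> v0 Av; rewrite /mx_spectrum /=; apply: contra v0 => u.
by rewrite -(mulKmx u v) mulmxBl Av mul_scalar_mx subrr mulmx0.
Qed.

(** * Chebyshev recurrence and approximation of spectral points *)

Section Density.
Variables (R : realType) (m : nat) (k l : m.-tuple R[i]).
Local Notation C := R[i].
Hypotheses (m0 : (0 < m)%N) (kpm : pm1 k) (lpm : pm1 l).
Local Notation p := (discriminant (per_ext k) (per_ext l) m).

(** A constant p would make E^M + E^-M scalar, yet it gives the unit vector at site M the value 1 at
    site 0. *)
Lemma size_discriminant : (1 < size p)%N.
Proof.
rewrite ltnNge; apply/negP => /size1_polyC pc.
pose u (j : int) : C := (j == (m + m)%:Z)%:R.
have [|su _] := @l2_finite_support _ u [:: (m + m)%:Z] isT.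
  by move=> j; rewrite inE /u => /negPf ->.
have := discriminant_A_per m0 kpm lpm (L2 (asboolT su)).
rewrite pc poly_actC => /(congr1 (fun x : l2 R => x 0)).
have mm : (0 == (m + m)%:Z) = false by apply/negbTE; lia.
have mN : (- (m + m)%:Z == (m + m)%:Z) = false by apply/negbTE; lia.
rewrite l2Z l2D !l2_shiftE /= /u !add0r eqxx mm mN mulr0 addr0.
by move/esym/eqP; rewrite oner_eq0.
Qed.

(** Both sides obey the same recurrence with the same first two values; the factor sin phi avoids a
    division. *)
Lemma sin_chebyshev (u : nat -> C) (phi : R) : u 0%N = 0 ->
  (forall n, u n.+2 + u n = (2 * cos phi)%:C * u n.+1) ->
  forall n, (sin phi)%:C * u n = (sin (n%:R * phi))%:C * u 1%N.
Proof.
move=> u0 ur n.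
suff [] : (sin phi)%:C * u n = (sin (n%:R * phi))%:C * u 1%N /\
  (sin phi)%:C * u n.+1 = (sin (n.+1%:R * phi))%:C * u 1%N by [].
elim: n => [|n [IH1 IH2]]; first by rewrite u0 mulr0 mul0r sin0 mul0r mul1r.
split=> //; have -> : u n.+2 = (2 * cos phi)%:C * u n.+1 - u n by rewrite -ur addrK.
rewrite mulrBr mulrCA IH1 IH2 mulrA -mulrBl -rmorphM -rmorphB; congr (_ %:C * _).
rewrite -!natr1 !mulrDl !mul1r !sinD cosD.
have := cos2Dsin2 phi; set c := cos phi; set s := sin phi => cs.
by rewrite -[X in _ - X = _]mulr1 -cs; ring.
Qed.

Lemma discriminant_root_sigma (N j : nat) (b : C) : (0 < j < N)%N ->
  p.[b] = (2 * cos (j%:R * pi / N%:R))%:C -> sigma_infty R b.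
Proof.
move=> /andP[j0 jN]; set phi := _ / _ => pb.
have [u [u0 u1 ur]] := sign_recurrence_solution b (per_ext_sqr m0 kpm) (per_ext_sqr m0 lpm).
have us (i : int) : u (i + (m + m)%:Z) + u (i - (m + m)%:Z) = p.[b] * u i.
  have := @discriminant_shift _ _ _ m (per_ext_sqr m0 kpm) (per_ext_sqr m0 lpm)
    (fun i q => q.[b] * u i) _ _ _ (per_ext_per k) (per_ext_per l) i 1.
  rewrite mulr1 !hornerE => -> //.
  - by move=> i' q r; rewrite hornerD mulrDl.
  - by move=> i' a q; rewrite hornerZ mulrA.
  - by move=> i' q; rewrite hornerM hornerX mulrAC -ur; ring.
have cheb := @sin_chebyshev (fun n => u (n * (m + m))%N) phi u0.
have N0 : (0 < N)%N by exact: leq_trans jN.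
have uN : u (N * (m + m))%N = 0.
  (* 0 < j < N puts phi strictly between 0 and pi, while N phi = j pi is a zero of the sine. *)
  have sphi : (sin phi)%:C != 0 :> C.
    rewrite -[0]/(0%:C) (inj_eq (@complexI _)) gt_eqF// sin_gt0_pi// /phi.
    rewrite divr_gt0 ?mulr_gt0 ?ltr0n ?pi_gt0//=.
    by rewrite ltr_pdivrMr ?ltr0n// mulrC ltr_pM2l ?pi_gt0// ltr_nat.
  apply: (mulfI sphi); rewrite mulr0 cheb.
    rewrite (_ : N%:R * phi = j%:R * pi); last first.
      by rewrite /phi mulrC divfK// pnatr_eq0 -lt0n.
    rewrite (_ : sin _ = 0) ?mul0r// mulr_natl.
    by elim: j {j0 jN phi pb cheb sphi} => [|i IH]; rewrite ?sin0// mulrS addrC sinDpi IH oppr0.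
  move=> n; have := us (n.+1 * (m + m))%N; rewrite pb => <-.
  congr (u _ + u _); rewrite !mulSn !PoszD; ring.
(* The zeros u_0 and u_(n+2) enclose u_1, ..., u_(n+1), a vector of the size of [A_fin], which is n
   + 1. *)
pose n := (N * (m + m)).-2.
have nE : (N * (m + m) = n.+2)%N.
  rewrite /n; have : (1 < N * (m + m))%N by nia.
  by case: (N * (m + m))%N => [|[]].
have n0 : (0 < n)%N by rewrite /n; nia.
exists n; split=> //.
pose k' := mktuple (fun i : 'I_n => per_ext k (i.+1)%:Z).
pose l' := mktuple (fun i : 'I_n => per_ext l (i.+1)%:Z).
have k'E i : (i < n)%N -> k'`_i = per_ext k i.+1.
  by move=> h; have := tnth_nth 0 k' (Ordinal h); rewrite tnth_mktuple => ->.
have l'E i : (i < n)%N -> l'`_i = per_ext l i.+1.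
  by move=> h; have := tnth_nth 0 l' (Ordinal h); rewrite tnth_mktuple => ->.
have pm (t : m.-tuple C) : pm1 t -> forall j, per_ext t j = 1 \/ per_ext t j = -1.
  by move=> tpm i; have /eqP := per_ext_sqr m0 tpm i; rewrite sqrf_eq1 => /orP[]/eqP ->; [left|right].
exists k', l'; split; [by move=> i; rewrite tnth_mktuple; exact: pm..|].
pose v : 'cV[C]_n.+1 := \col_i u i.+1.
apply: (@mx_spectrum_eigenvector _ _ _ _ v).
  by apply/eqP => /matrixP/(_ 0 0)/eqP; rewrite !mxE u1 oner_eq0.
apply/matrixP => i z; rewrite !mxE; under eq_bigr do rewrite [v _ _]mxE.
rewrite (A_fin_mulE k' l' (f := fun n => u n)) ?u0// -?nE//.
have iE : i.+1%:Z - 1 = i by rewrite intS addrAC subrr add0r.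
rewrite -ur iE -PoszD addn1; congr (_ + _).
  case: i {iE} => [[|i'] ilt] /=; first by rewrite u0 !mulr0.
  by rewrite k'E.
have [/l'E -> //|ni] := ltnP i n.
have -> : i.+2 = n.+2 by have := ltn_ord i; lia.
by rewrite -nE uN !mulr0.
Qed.

Lemma spectrum_closure : spectrum (A_per k l) `<=` closure (sigma_infty R).
Proof.
move=> a /(spectrum_A_per m0 kpm lpm)[t t1 pa] B /nbhs_ballP[d /= d0 dB].
have [e e0 eP] := poly_root_near a size_discriminant d0.
have e0' : 0 < complex.Re e.
  by move: e0; case: (e) => x y; rewrite ltcE /= => /andP[].
(* The tolerance is halved because p takes the value 2 cos; e, being positive in [R[i]], is real. *)
have [N [j [jN cN]]] := cos_rational_dense t1 (divr_gt0 e0' (ltr0Sn _ 1)).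
have [|b bE bd] := eP (2 * cos (j%:R * pi / N%:R))%:C.
  have eE : e = (complex.Re e)%:C.
    by move: e0; case: (e) => x y; rewrite ltcE /= => /andP[/eqP ->].
  rewrite pa -rmorphB -mulrBr [X in X < _]normc_def /= expr0n addr0 sqrtr_sqr eE ltcR.
  by rewrite normrM gtr0_norm// mulrC -ltr_pdivlMr.
exists b; split; first exact: discriminant_root_sigma bE.
by apply: dB; rewrite /ball /= distrC.
Qed.
End Density.

(** * Eigenvalues of A_fin *)

(** Cut the periodic solution to N periods: T - a sends the result X to a Y living on four sites
    near the cuts and bounded independently of N, while the mass of X grows linearly in N. A bounded
    inverse forbids this. *)
Lemma periodic_solution_spectrum (R : realType) (m : nat) (k l : m.-tuple R[i])
    (a : R[i]) (W : nat -> R[i]) (s0 : nat) : (0 < m)%N -> pm1 k -> pm1 l ->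
  (s0 < m)%N -> W s0 != 0 ->
  (forall j : int, per_ext k (j - 1) * W `|((j - 1) %% m)%Z|%N +
     per_ext l j * W `|((j + 1) %% m)%Z|%N = a * W `|(j %% m)%Z|%N) ->
  spectrum (A_per k l) a.
Proof.
move=> m0 kpm lpm s0m W0 sol [S [Sc Sl _]].
have := Sc; move/linear_bounded_continuous/linear_boundedP/pinfty_ex_gt0 => [r r0 Sr].
have rE : r = (complex.Re r)%:C.
  by move: r0; case: (r) => x y; rewrite ltcE /= => /andP[/eqP ->].
set rr := complex.Re r in rE.
have rr0 : 0 <= rr by rewrite -lecR -rE ltW.
pose u (j : int) := W `|(j %% m)%Z|%N.
pose B := \sum_(s < m) normc (W s).
have B0 : 0 <= B by apply: sumr_ge0 => s _; exact: normc_ge0.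
have mz : m%:Z != 0 by rewrite eqz_nat -lt0n.
have mod_lt (j : int) : (`|(j %% m)%Z| < m)%N.
  by rewrite -ltz_nat gez0_abs ?modz_ge0// ltz_pmod.
have uB j : normc (u j) <= B.
  rewrite /B (bigD1 (Ordinal (mod_lt j)))//= lerDl.
  by apply: sumr_ge0 => s _; exact: normc_ge0.
(* Two neighbours with sign coefficients and a times the centre, each value at most B. *)
pose D := (2 + normc a) * B.
have D0 : 0 <= D by rewrite mulr_ge0// addr_ge0// normc_ge0.
suff bound (N : nat) : N%:R * normc (W s0) ^+ 2 <= rr ^+ 2 * (4 * D ^+ 2).
  have c0 : 0 < normc (W s0) ^+ 2.
    rewrite exprn_gt0// lt_def normc_ge0 andbT.
    by apply: contra W0 => /eqP/eq0_normc ->.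
  pose q := rr ^+ 2 * (4 * D ^+ 2) / normc (W s0) ^+ 2.
  have q0 : 0 <= q.
    apply: divr_ge0; last exact: ltW.
    by apply: mulr_ge0; [exact: sqr_ge0|apply: mulr_ge0; last exact: sqr_ge0].
  have /andP[_] := truncn_itv q0.
  by apply/negP; rewrite -leNgt ler_pdivlMr// bound.
pose x (j : int) := if (0 <= j) && (j < (N * m)%:Z) then u j else 0.
have xB j : normc (x j) <= B by rewrite /x; case: ifP => // _; rewrite normc0.
have [||sx _] := @l2_finite_support _ x [seq Posz i | i <- iota 0 (N * m)].
- by rewrite map_inj_uniq ?iota_uniq// => ? ? [].
- move=> j /mapP jn; rewrite /x; case: ifP => // /andP[j0 jN]; case: jn.
  by exists `|j|%N; [rewrite mem_iota add0n/=; lia|lia].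
pose X : l2 R := L2 (asboolT sx).
pose Y := A_per k l X - a *: X.
have YE j : Y j = per_ext k (j - 1) * x (j - 1) + per_ext l j * x (j + 1) - a * x j.
  by rewrite /Y l2D l2N l2Z A_perE.
have normc_per (t : m.-tuple R[i]) j : pm1 t -> normc (per_ext t j) = 1.
  move=> tpm; have /eqP := per_ext_sqr m0 tpm j.
  by rewrite sqrf_eq1 => /orP[]/eqP ->; rewrite ?normcN normc1.
have YD j : normc (Y j) <= D.
  rewrite YE /D mulrDl mulr_natl mulr2n; apply: le_trans (le_normcD _ _) _.
  apply: lerD; last by rewrite normcN normcM ler_wpM2l// normc_ge0.
  apply: le_trans (le_normcD _ _) _.
  by rewrite !normcM !normc_per// !mul1r lerD.
(* [undup] is there because the four sites overlap when N m <= 1. *)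
have [||_ Ymass] := @l2_finite_support _ Y (undup [:: -1; 0; (N * m)%:Z - 1; (N * m)%:Z]).
- exact: undup_uniq.
- move=> j; rewrite mem_undup !inE !negb_or => /and4P[j1 j2 j3 j4].
  rewrite YE /x; have := sol j; rewrite -/(u _) -/(u _) -/(u _).
  have [jin|jout] := boolP ((0 <= j) && (j < (N * m)%:Z)).
    by rewrite !ifT ?jin; [move=> ->; rewrite subrr|lia..].
  by rewrite !ifF ?(negbTE jout) ?mulr0 ?addr0 ?subr0//; lia.
have Ym : l2_mass Y <= 4 * D ^+ 2.
  apply: le_trans Ymass _.
  apply: (@le_trans _ _ (\sum_(j <- undup [:: -1; 0; (N * m)%:Z - 1; (N * m)%:Z]) D ^+ 2)).
    by apply: ler_sum => j _; rewrite ler_sqr ?nnegrE ?normc_ge0.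
  rewrite big_const_seq count_predT iter_addr_0 -[leLHS]mulr_natl ler_wpM2r ?sqr_ge0//.
  by rewrite ler_nat; exact: size_undup.
have XY : l2_mass X <= rr ^+ 2 * l2_mass Y.
  have := Sr Y; rewrite /Y Sl !l2_normE rE -rmorphM lecR -/Y => h.
  rewrite -[leLHS]sqr_sqrtr ?l2_mass_ge0// -[in leRHS](sqr_sqrtr (l2_mass_ge0 Y)) -exprMn.
  by rewrite ler_sqr ?nnegrE ?sqrtr_ge0 ?mulr_ge0 ?sqrtr_ge0.
apply: (@le_trans _ _ (rr ^+ 2 * l2_mass Y)); last by rewrite ler_wpM2l ?sqr_ge0.
apply: le_trans XY.
have up : uniq [seq (s0 + i * m)%N%:Z | i <- iota 0 N].
  rewrite map_inj_uniq ?iota_uniq// => i j [] /addnI/eqP.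
  by rewrite eqn_pmul2r// => /eqP.
apply: le_trans (l2_mass_ub (sx : sq_summable X) up); rewrite big_map.
rewrite (eq_big_seq (fun=> normc (W s0) ^+ 2)); last first.
  move=> i; rewrite mem_iota add0n => /= iN; rewrite /x ifT; last by nia.
  by rewrite /u modz_nat absz_nat addnC modnMDl modn_small.
by rewrite big_const_seq count_predT iter_addr_0 size_iota mulr_natl.
Qed.

Lemma modz_shift (m : nat) (j : int) : (0 < m)%N ->
  exists2 s : nat, (s < m)%N & [/\ `|(j %% m)%Z|%N = s,
    `|((j + 1) %% m)%Z|%N = (s.+1 %% m)%N &
    `|((j - 1) %% m)%Z|%N = ((s + m).-1 %% m)%N].
Proof.
move=> m0; have mz : m%:Z != 0 by rewrite eqz_nat -lt0n.
have sE : (j %% m)%Z = `|(j %% m)%Z|%N by rewrite gez0_abs ?modz_ge0.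
exists `|(j %% m)%Z|%N; first by rewrite -ltz_nat -sE ltz_pmod.
set s := `|_|%N in sE *; have jE := divz_eq j m; rewrite sE in jE.
split=> //; rewrite {1}jE -addrA modzMDl.
  by rewrite -PoszD addn1 modz_nat.
by rewrite -modzDr (_ : s%:Z - 1 + m = (s + m).-1); [rewrite modz_nat|lia].
Qed.

Lemma A_fin_eigenvector (R : realType) (n : nat) (k l : n.-tuple R[i]) (a : R[i]) :
  mx_spectrum (A_fin k l) a -> exists f : nat -> R[i],
  [/\ f 0%N = 0, f n.+2 = 0, exists2 s, (s < n.+2)%N & f s != 0 &
   forall i, (i < n.+1)%N -> k`_i.-1 * f i + l`_i * f i.+2 = a * f i.+1].
Proof.
(* [det0P] produces a row vector in the left kernel, hence the transpose. *)
rewrite /mx_spectrum /= -unitmx_tr unitmxE unitfE negbK => /det0P[v v0 vA].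
pose f (i : nat) := if i is j.+1 then (if insub j is Some j' then v 0 j' else 0) else 0.
have fE (j : 'I_n.+1) : f j.+1 = v 0 j by rewrite /f valK.
have fn : f n.+2 = 0 by rewrite /f insubF// ltnn.
exists f; split=> //.
  have [j vj] : exists j, v 0 j != 0.
    apply/existsP; apply: contraR v0 => /existsPn v0; apply/eqP/rowP => j.
    by rewrite mxE; have := v0 j; rewrite negbK => /eqP.
  by exists j.+1; [rewrite ltnS|rewrite fE].
move=> i ilt; rewrite -(@A_fin_mulE _ _ k l f (Ordinal ilt))//.
have Av : A_fin k l *m v^T = a *: v^T.
  apply/eqP; rewrite -subr_eq0 -mul_scalar_mx -mulmxBl -(inj_eq trmx_inj).
  by rewrite trmx_mul trmxK vA trmx0.
have /matrixP/(_ (Ordinal ilt) 0) := Av; rewrite !mxE -(fE (Ordinal ilt)) => <-.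
by apply: eq_bigr => j _; rewrite fE !mxE.
Qed.

(** * Periodic extension of a finite eigenvector by reflection *)

Section Reflection.
Variables (R : realType) (n : nat) (k l : n.-tuple R[i]) (a : R[i]) (f : nat -> R[i]).
Local Notation C := R[i].
Local Notation L := n.+2.
Local Notation M := (L + L)%N.
Hypotheses (kpm : pm1 k) (lpm : pm1 l).

(** The entry from site s to s + 1 on a cycle of length M. The default 1 of [nth] supplies a sign
    where the finite matrix has no entry. *)
Definition reflected_sub (s : nat) : C :=
  if (s < L)%N then nth 1 k s.-1 else nth 1 l (M - s)%N.-2.

(* The signs of the two superdiagonal entries out of the zeros 0 and L of the
   reflected eigenvector are chosen so that both neighbours cancel. *)
Definition reflected_super (s : nat) : C :=
  if s == 0%N then - reflected_sub M.-1
  else if s == L then - reflected_sub L.-1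
  else if (s < L)%N then nth 1 l s.-1 else nth 1 k (M - s)%N.-2.

Definition reflected (s : nat) : C := f (if (s <= L)%N then s else (M - s)%N).

Lemma nth_pm1 (t : n.-tuple C) i : pm1 t -> nth 1 t i = 1 \/ nth 1 t i = -1.
Proof.
move=> tpm; have [ilt|ni] := ltnP i n; last by left; rewrite nth_default// size_tuple.
by have := tpm (Ordinal ilt); rewrite (tnth_nth 1).
Qed.

Lemma pm1N (x : C) : x = 1 \/ x = -1 -> - x = 1 \/ - x = -1.
Proof. by case=> ->; rewrite ?opprK; [right|left]. Qed.

Lemma reflected_sub_pm1 s : reflected_sub s = 1 \/ reflected_sub s = -1.
Proof. by rewrite /reflected_sub; case: ifP => _; exact: nth_pm1. Qed.

Lemma reflected_super_pm1 s : reflected_super s = 1 \/ reflected_super s = -1.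
Proof.
rewrite /reflected_super; do 3?[case: ifP => _]; do ?[exact: nth_pm1];
  exact/pm1N/reflected_sub_pm1.
Qed.

Hypotheses (f0 : f 0%N = 0) (fL : f L = 0).
Hypothesis fE : forall i, (i < n.+1)%N ->
  k`_i.-1 * f i + l`_i * f i.+2 = a * f i.+1.

(** Sites below L carry the original rows and sites above L the same rows read backwards. At 0 and L
    the two neighbours have equal values and opposite coefficients. *)
Lemma reflectedE s : (s < M)%N ->
  reflected_sub ((s + M).-1 %% M) * reflected ((s + M).-1 %% M) +
  reflected_super s * reflected (s.+1 %% M) = a * reflected s.
Proof.
(* Passing from default 0 to default 1 only alters coefficients of f 0 and f L, both zero. *)
have row i : (i < n.+1)%N ->
    nth 1 k i.-1 * f i + nth 1 l i * f i.+2 = a * f i.+1.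
  move=> ilt; rewrite -fE//; congr (_ + _).
    case: i ilt => [|i] ilt; first by rewrite f0 !mulr0.
    by rewrite (set_nth_default 0)// size_tuple.
  have [iltn|ni] := ltnP i n; first by rewrite (set_nth_default 0)// size_tuple.
  have -> : i.+2 = L by lia.
  by rewrite fL !mulr0.
move=> sM; case: s sM => [_|s sM].
  have e1 : (M.-1 %% M)%N = M.-1 by apply: modn_small; lia.
  have e2 : (1 %% M)%N = 1%N by apply: modn_small; lia.
  rewrite add0n e1 e2.
  have r1 : reflected M.-1 = f 1.
    rewrite /reflected ifF; last by lia.
    by congr f; lia.
  by rewrite r1 /reflected_super /reflected /= f0 mulr0 mulNr subrr.
rewrite addSn /= modnDr modn_small; last by lia.
have [sL|sL|sL] := ltngtP s.+1 L.
- rewrite modn_small; last by lia.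
  have low i : (i <= L)%N -> reflected i = f i by rewrite /reflected => ->.
  rewrite !low; [|lia..].
  rewrite /reflected_sub /reflected_super (ltnW sL) (ltn_eqF sL) sL /=.
  by apply: row; lia.
(* r + 1 is the mirror image of site s + 1; reflection swaps its neighbours, hence k and l. *)
- have [r rE] : exists r, M = (s + r.+2)%N by exists (M - s.+2)%N; lia.
  have up : reflected (s.+2 %% M)%N = f r.
    have [sM'|Ms] := ltnP s.+2 M.
      rewrite modn_small// /reflected ifF; last by lia.
      by congr f; lia.
    have -> : s.+2 = M by lia.
    by rewrite modnn /reflected; congr f; lia.
  have dn : reflected s = f r.+2.
    rewrite /reflected; case: ifP => sL'; last by congr f; lia.
    by congr f; lia.
  have here : reflected s.+1 = f r.+1.
    rewrite /reflected ifF; last by lia.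
    by congr f; lia.
  have sLF : (s < L)%N = false by lia.
  have sLF' : (s.+1 < L)%N = false by lia.
  have sLF2 : (s.+1 == L) = false by lia.
  rewrite up dn here /reflected_sub /reflected_super sLF sLF' sLF2 /=.
  have -> : ((M - s).-2 = r)%N by lia.
  have -> : ((M - s.+1).-2 = r.-1)%N by lia.
  by rewrite addrC; apply: row; lia.
- have [dn here up] : [/\ reflected s = f n.+1, reflected s.+1 = 0 &
      reflected (s.+2 %% M)%N = f n.+1].
    split.
    + by rewrite /reflected ifT; [congr f; lia|lia].
    + by rewrite /reflected sL leqnn fL.
    rewrite sL modn_small; last by lia.
    rewrite /reflected ifF; last by lia.
    by congr f; lia.
  rewrite up dn here mulr0 /reflected_super sL eqxx /=.
  have -> : s = n.+1 by lia.
  by rewrite mulNr subrr.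
Qed.

Lemma reflected_spectrum s : (s < L)%N -> f s != 0 -> pi_infty R a.
Proof.
move=> sL fs.
(* [per_ext] reads index j - 1 at site j, so the value for site 0 goes last in the tuple. *)
pose t (F : nat -> C) := mktuple (fun r : 'I_M => F (r.+1 %% M)%N).
have tE F j : per_ext (t F) j = F `|(j %% M)%Z|%N.
  have [r rM [r1 r2 _]] := modz_shift (j - 1) (isT : (0 < M)%N).
  rewrite subrK in r2; rewrite /per_ext r1 r2.
  by have := tnth_nth 0 (t F) (Ordinal rM); rewrite tnth_mktuple => <-.
have tpm F : (forall s, F s = 1 \/ F s = -1) -> pm1 (t F).
  by move=> FP r; rewrite tnth_mktuple.
exists M; split=> //; exists (t reflected_sub), (t reflected_super).
split; [exact/tpm/reflected_sub_pm1|exact/tpm/reflected_super_pm1|].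
apply: (@periodic_solution_spectrum _ _ _ _ _ reflected s) => //.
- exact/tpm/reflected_sub_pm1.
- exact/tpm/reflected_super_pm1.
- by rewrite ltn_addr.
- by rewrite /reflected ltnW.
move=> j; rewrite !tE; have [r rM [-> -> ->]] := modz_shift j (isT : (0 < M)%N).
exact: reflectedE.
Qed.
End Reflection.

Lemma sigma_sub_pi (R : realType) : sigma_infty R `<=` pi_infty R.
Proof.
move=> a [n [n0 [k [l [kpm lpm]]]]] /A_fin_eigenvector[f [f0 fn [s sn fs] fE]].
exact: (reflected_spectrum kpm lpm f0 fn fE sn fs).
Qed.

Theorem theorem1 (R : realType) :
  sigma_infty R `<=` pi_infty R /\ pi_infty R `<=` closure (sigma_infty R).
Proof.
split; first exact: sigma_sub_pi.
by move=> a [m [m0 [k [l [kpm lpm]]]]]; exact: spectrum_closure.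
Qed.
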